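(* Let $0<q<1$. On $\mathcal{L}_0=\mathcal{A}(\mathbb{C}P^1_q)$, for every $N\in\mathbb{N}$ there exists a $\bar\partial$-connection $\overline\nabla$ such that $\dim\ker\overline\nabla\ge N$.
   Context: Algebras. $\mathcal{A}(SU_q(2))$ is the unital $*$-algebra generated by $a,c$ with relations $ac=qca$, $ac^*=qc^*a$, $cc^*=c^*c$, $a^*a+c^*c=aa^*+q^2cc^*=1$. It is a Hopf $*$-algebra with coproduct $\Delta(a)=a\otimes a-qc^*\otimes c$, $\Delta(c)=c\otimes a+a^*\otimes c$. $\mathcal{A}(\mathbb{C}P^1_q)$ is the unital $*$-subalgebra generated by $B_-=ac^*$, $B_+=ca^*=B_-^*$, $B_0=cc^*$. $\mathcal{L}_{-2}\subset\mathcal{A}(SU_q(2))$ is the $\mathcal{A}(\mathbb{C}P^1_q)$-sub-bimodule generated by $a^2,ca,c^2$. Forms. $\Omega^{0,1}=\Omega^{0,1}(\mathbb{C}P^1_q)=\mathcal{L}_{-2}\omega_-$, where $\omega_-$ is a free generator commuting with $\mathcal{A}(\mathbb{C}P^1_q)$; it is an $\mathcal{A}(\mathbb{C}P^1_q)$-bimodule. $\bar\partial:\mathcal{A}(\mathbb{C}P^1_q)\to\Omega^{0,1}$ is the derivation with $\bar\partial B_0=-q^{-1/2}ca\,\omega_-$, $\bar\partial B_+=q^{1/2}c^2\omega_-$, $\bar\partial B_-=-q^{-1/2}a^2\omega_-$. Completions. $\mathcal{C}(SU_q(2))$ is the universal $C^*$-algebra generated by $a,c$ subject to the relations $ac=qca$,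 $ac^*=qc^*a$, $cc^*=c^*c$, $a^*a+c^*c=aa^*+q^2cc^*=1$, $h$ its unique left-invariant state (Haar state), $L^2(SU_q(2))$ the GNS space of $h$, and $L^2(\mathbb{C}P^1_q)$ the closure of $\mathcal{A}(\mathbb{C}P^1_q)$ in $L^2(SU_q(2))$. $L^2(\Omega^{0,1})$ is the closure of $\mathcal{L}_{-2}$ in $L^2(SU_q(2))$, with $x\omega_-$ identified with $x$. The operator $\bar\partial$ is closable from $L^2(\mathbb{C}P^1_q)$ to $L^2(\Omega^{0,1})$; its closure is also denoted $\bar\partial$, with domain $\mathrm{Dom}(\bar\partial)$. Connections. A $\bar\partial$-connection on $\mathcal{L}_0$ is a linear map $\overline\nabla:\mathcal{L}_0\to\Omega^{0,1}$ with $\overline\nabla(fs)=\bar\partial(f)s+f\overline\nabla(s)$ for $f,s\in\mathcal{A}(\mathbb{C}P^1_q)$; equivalently $\overline\nabla=\overline\nabla_\theta$, $\overline\nabla_\theta(s)=\bar\partial s-s\theta$, for a unique $\theta\in\Omega^{0,1}$. Right multiplication by $\theta$ is $L^2$-bounded, so $\overline\nabla_\theta$ extends to a closed operator $\mathrm{Dom}(\bar\partial)\to L^2(\Omega^{0,1})$ by the same formula, and $\ker\overline\nabla_\theta$ denotes the kernel of this closed extension. *)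

(* Defs.v *)
From HB Require Import structures.
From mathcomp Require Import all_boot all_order all_algebra.
From mathcomp Require Import sesquilinear complex.
From mathcomp Require Import all_classical all_reals all_analysis.

Set Implicit Arguments.
Unset Strict Implicit.
Unset Printing Implicit Defensive.

Import Order.TTheory GRing.Theory Num.Theory.
Import numFieldNormedType.Exports.

Local Open Scope classical_set_scope.
Local Open Scope ring_scope.
Local Open Scope complex_scope.

HB.mixin Record isStarAlgebra (K : numClosedFieldType) A
    of GRing.Algebra K A := {
  star : A -> A;
  starK : involutive star;
  starD : forall x y, star (x + y) = star x + star y;
  starM : forall x y, star (x * y) = star y * star x;
  starZ : forall (k : K) x, star (k *: x) = Num.conj k *: star x
}.

#[short(type="starAlgType")]
HB.structure Definition StarAlgebra (K : numClosedFieldType) :=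
  {A of GRing.Algebra K A & isStarAlgebra K A}.

(* A normed ring cannot inherit both from GRing.PzRing and from
   Num.NormedZmodule, whose join is already taken by Num.NumDomain; hence the
   separate norm. As for the norms of the library, its values are nonnegative
   elements of [K]. *)
HB.mixin Record isCstarAlgebra (K : numClosedFieldType) A
    of StarAlgebra K A := {
  cnorm : A -> K;
  cnorm0_eq0 : forall x, cnorm x = 0 -> x = 0;
  cnormD : forall x y, cnorm (x + y) <= cnorm x + cnorm y;
  cnormZ : forall (k : K) x, cnorm (k *: x) = `|k| * cnorm x;
  cnormM : forall x y, cnorm (x * y) <= cnorm x * cnorm y;
  cnorm_starM : forall x, cnorm (star x * x) = cnorm x ^+ 2;
  cnorm_complete : forall u : nat -> A,
    (forall e : K, 0 < e -> exists n, forall i j,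
      (n <= i)%N -> (n <= j)%N -> cnorm (u i - u j) < e) ->
    exists l, forall e : K, 0 < e -> exists n, forall i,
      (n <= i)%N -> cnorm (u i - l) < e
}.

#[short(type="cstarAlgType")]
HB.structure Definition CstarAlgebra (K : numClosedFieldType) :=
  {A of StarAlgebra K A & isCstarAlgebra K A}.

Definition star_preserving (K : numClosedFieldType) (A B : starAlgType K)
  (f : A -> B) := forall x, f (star x) = star (f x).

Section Algebras.
Variables (R : realType) (q : R).

Definition SUq2_relations (A : starAlgType R[i]) (a c : A) : Prop :=
  [/\ a * c = q%:C *: (c * a),
      a * star c = q%:C *: (star c * a),
      c * star c = star c * c,
      star a * a + star c * c = 1 &
      a * star a + (q ^+ 2)%:C *: (c * star c) = 1].

(* [A], with generators [a] and [c], is the *-algebra A(SU_q(2)). *)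
Definition is_SUq2 (A : starAlgType R[i]) (a c : A) : Prop :=
  SUq2_relations a c /\
  forall (B : starAlgType R[i]) (b d : B), SUq2_relations b d ->
    exists f : {lrmorphism A -> B},
      [/\ star_preserving f, f a = b, f c = d &
          forall g : {lrmorphism A -> B},
            star_preserving g -> g a = b -> g c = d -> g =1 f].

(* [C], with generators [a] and [c], is the C*-algebra C(SU_q(2)). *)
Definition is_cstar_SUq2 (C : cstarAlgType R[i]) (a c : C) : Prop :=
  SUq2_relations a c /\
  forall (B : cstarAlgType R[i]) (b d : B), SUq2_relations b d ->
    exists f : {lrmorphism C -> B},
      [/\ star_preserving f, f a = b, f c = d &
          forall g : {lrmorphism C -> B},
            star_preserving g -> g a = b -> g c = d -> g =1 f].

(* [T] with [tens x y = x (x) y] is the algebraic tensor product *-algebra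
   of [A] with itself. *)
Definition is_tensor_square (A T : starAlgType R[i])
    (tens : {bilinear A -> A -> T}) : Prop :=
  [/\ forall x y x' y', tens x y * tens x' y' = tens (x * x') (y * y'),
      tens 1 1 = 1,
      forall x y, star (tens x y) = tens (star x) (star y) &
      forall (V : lmodType R[i]) (f : {bilinear A -> A -> V}),
        exists g : {linear T -> V},
          (forall x y, g (tens x y) = f x y) /\
          forall g' : {linear T -> V},
            (forall x y, g' (tens x y) = f x y) -> g' =1 g].

Definition is_coproduct (A T : starAlgType R[i]) (a c : A)
    (tens : A -> A -> T) (Delta : {lrmorphism A -> T}) : Prop :=
  [/\ star_preserving Delta,
      Delta a = tens a a - q%:C *: tens (star c) c &
      Delta c = tens c a + tens (star a) c].

Definition is_state (C : cstarAlgType R[i]) (h : {scalar C}) : Prop :=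
  (forall x, 0 <= h (star x * x)) /\ h 1 = 1.

(* (id (x) phi) o Delta = phi(.) 1; [S] is the slice map id (x) phi. A state of
   C(SU_q(2)) is continuous, so that its left invariance is a condition on its
   restriction [phi] to the dense subalgebra A(SU_q(2)), where the coproduct
   has values in the algebraic tensor product. *)
Definition left_invariant (A T : starAlgType R[i])
    (tens : A -> A -> T) (Delta : A -> T) (phi : A -> R[i]) : Prop :=
  forall S : {linear T -> A}, (forall x y, S (tens x y) = phi y *: x) ->
    forall x, S (Delta x) = phi x *: 1.

(* [Lambda] is the canonical map of [C] into the GNS space [H] of [h]; the
   forms of {dot _ for _} are linear in their first argument. *)
Definition is_GNS_space (C : cstarAlgType R[i]) (h : C -> R[i])
    (H : completeNormedModType R[i]) (dot : {dot H for Num.conj})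
    (Lambda : C -> H) : Prop :=
  [/\ forall u : H, `|u| ^+ 2 = dot u u,
      forall x y, dot (Lambda x) (Lambda y) = h (star y * x) &
      closure (range Lambda) = setT].

End Algebras.

Section Forms.
Variables (R : realType) (q : R) (A : starAlgType R[i]) (a c : A).

Definition star_subalgebra (S : set A) : Prop :=
  [/\ S 1,
      forall (k : R[i]) x y, S x -> S y -> S (k *: x + y),
      forall x y, S x -> S y -> S (x * y) &
      forall x, S x -> S (star x)].

Definition sub_bimodule (S M : set A) : Prop :=
  [/\ M 0,
      forall x y, M x -> M y -> M (x + y),
      forall f x, S f -> M x -> M (f * x) &
      forall f x, S f -> M x -> M (x * f)].

Definition Bminus := a * star c.
Definition Bplus := c * star a.
Definition Bzero := c * star c.

(* A(CP^1_q), which is also L_0. *)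
Definition CP1q : set A :=
  smallest star_subalgebra [set Bminus; Bplus; Bzero].

(* L_{-2}. As omega_- is a free generator commuting with A(CP^1_q), the map
   x |-> x omega_- is an isomorphism of A(CP^1_q)-bimodules from L_{-2} onto
   Omega^{0,1}; an element x omega_- of Omega^{0,1} is represented by x. *)
Definition Omega01 : set A :=
  smallest (sub_bimodule CP1q) [set a ^+ 2; c * a; c ^+ 2].

(* Linear maps A(CP^1_q) -> Omega^{0,1} are represented by functions A -> A,
   whose values outside A(CP^1_q) are irrelevant. *)
Definition linear_to_Omega01 (f : A -> A) : Prop :=
  (forall x, CP1q x -> Omega01 (f x)) /\
  (forall (k : R[i]) x y, CP1q x -> CP1q y ->
    f (k *: x + y) = k *: f x + f y).

Definition is_dbar (dbar : A -> A) : Prop :=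
  [/\ linear_to_Omega01 dbar,
      forall x y, CP1q x -> CP1q y ->
        dbar (x * y) = dbar x * y + x * dbar y,
      dbar Bzero = - ((Num.sqrt q)^-1)%:C *: (c * a),
      dbar Bplus = (Num.sqrt q)%:C *: c ^+ 2 &
      dbar Bminus = - ((Num.sqrt q)^-1)%:C *: a ^+ 2].

Definition is_dbar_connection (dbar nabla : A -> A) : Prop :=
  linear_to_Omega01 nabla /\
  forall f s, CP1q f -> CP1q s ->
    nabla (f * s) = dbar f * s + f * nabla s.

Section L2.
Variables (H : completeNormedModType R[i]) (j : A -> H).

(* Graph of the closure of the operator j x |-> j (f x), x in A(CP^1_q), from
   L^2(CP^1_q), the closure of j(A(CP^1_q)), to L^2(Omega^{0,1}), the closure
   of j(L_{-2}). Closing up in H * H amounts to closing up in the product of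
   these two closed subspaces. *)
Definition closed_graph (f : A -> A) : set (H * H) :=
  closure [set (j x, j (f x)) | x in CP1q].

(* Graph of s |-> dbar s - s theta on Dom(dbar), for the closed operator dbar;
   for f = (. * theta), which is L^2-bounded, [closed_graph f] is the graph of
   the bounded extension of f to L^2(CP^1_q). *)
Definition nabla_graph (dbar : A -> A) (theta : A) : set (H * H) :=
  [set p | exists t u, [/\ closed_graph dbar (p.1, t),
     closed_graph (fun s => s * theta) (p.1, u) & p.2 = t - u]].

Definition ker_nabla (dbar : A -> A) (theta : A) : set H :=
  [set s | nabla_graph dbar theta (s, 0)].

End L2.
End Forms.

(* For [W] a linear subspace of [V]: the dimension of [W], possibly infinite,
   is at least [N]. *)
Definition dim_ge (K : fieldType) (V : lmodType K) (W : set V) (N : nat) :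
    Prop :=
  exists v : 'I_N -> V, (forall i, W (v i)) /\
    forall l : 'I_N -> K, \sum_i l i *: v i = 0 -> forall i, l i = 0.

(* Main.v *)
Require Import Defs.
From HB Require Import structures.
From mathcomp Require Import all_boot all_order all_algebra.
From mathcomp Require Import sesquilinear complex.
From mathcomp Require Import all_classical all_reals all_analysis.
From mathcomp Require Import ring lra zify.
Import Order.TTheory GRing.Theory Num.Theory.
Import numFieldNormedType.Exports.

Set Implicit Arguments.
Unset Strict Implicit.
Unset Printing Implicit Defensive.

Local Open Scope classical_set_scope.
Local Open Scope ring_scope.
Local Open Scope complex_scope.

(** Formally the derivation is a commutator: with
    X = q^(-1/2) / (1 - q^2) B_0^(-1) c a one has dbar f = X f - f X, so that
    a solution of dbar s = s theta is an intertwiner X s = s (X + theta).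
    Represent the functions on l^2(N), where B_0 e_k = q^(2k) e_k and X is a
    weighted backward shift; in particular X e_0 = 0. If theta is of the form
    p(B_0) c a, then X + theta is again a weighted backward shift, with weights
    governed by B_0^(-1) + (constant) p(B_0), and a polynomial p can be chosen
    to kill the first N weights: it only has to take prescribed values at
    1, q^2, ..., q^(2(N-1)). The matrix units E_{0i}, i < N, are then
    annihilated by X on the left and by X + theta on the right, hence they are
    N independent solutions. Classically the equation would force a solution to
    vanish only at isolated points; here noncommutativity leaves room for
    solutions with orthogonal supports.

    The matrix unit E_{0i} is not polynomial, but it is, up to a factor, the
    limit of the polynomials B_0^n B_-^i as n grows, because B_0^n tends to the
    projection on e_0. The argument is carried out on these approximants,
    without l^2(N): both dbar (B_0^(n+1) B_-^i) and B_0^n B_-^i theta are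
    combinations of the elements B_0^m B_-^i c a ([dbar_word], [BmX_B0X]), and
    these converge as well ([word_ca_cvg]), so that both sides of the equation
    have limits, equal by the choice of p ([dbar_zero_mode],
    [cutoff_zero_mode]).

    Convergence and independence are read off from inner products, that is,
    from the values of the Haar state phi on the elements B_+^i B_0^n B_-^i.
    These are explicit ([phi_word]) and depend only on the total exponent of
    B_0, whence the Cauchy property ([gram_cvg]); their limits are positive
    and words of different degree i are orthogonal ([moment_weight]), whence
    independence ([gram_free]). The values of phi come from left invariance:
    slicing the coproduct with the coefficients of a two-dimensional
    representation of the algebra gives a twisted derivation and a rescaling
    of the generators under which phi is invariant ([ex_coef_action]), and the
    twisted derivation yields a recursion for phi(B_0^k) ([moment_rec]). *)

(** * Involutions *)

Lemma conjC_real (R : realType) (x : R) : Num.conj (x%:C : R[i]) = x%:C.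
Proof. by apply: conj_Creal; rewrite complex_real. Qed.

Section Involution.
Variables (K : numClosedFieldType) (A : starAlgType K).

Lemma starN (x : A) :
  star (- x) = - star x.
Proof. by rewrite -scaleN1r starZ rmorphN1 scaleN1r. Qed.

Lemma star1 : star (1 : A) = 1.
Proof.
by rewrite -[star 1]mulr1 -{2}[1 : A]starK -starM mulr1 starK.
Qed.

Lemma star_exp (x : A) n : star (x ^+ n) = star x ^+ n.
Proof.
by elim: n => [|n IH]; rewrite ?expr0 ?star1 // exprS starM IH exprSr.
Qed.

Lemma star_sum (I : Type) (s : seq I) (F : I -> A) :
  star (\sum_(i <- s) F i) = \sum_(i <- s) star (F i).
Proof.
apply: (big_morph _ (@starD _ _)).
by rewrite -[0 in LHS](subrr 1) starD starN subrr.
Qed.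

End Involution.

(** * A triangular representation by 2 x 2 matrices *)

Section MatrixDouble.
Variables (K : numClosedFieldType) (n : nat).

(** The double M x M of a matrix algebra, where the involution exchanges the two
    factors. An arbitrary algebra homomorphism f into M, compatible or not with
    the adjoint, becomes the first component of a *-homomorphism into the
    double, the second component being the adjoint of f (star x). This turns
    the universal property of a *-algebra into one for all its
    representations. *)
Definition mxdouble : Type := ('M[K]_n.+1 * 'M[K]_n.+1)%type.
HB.instance Definition _ := GRing.Algebra.on mxdouble.

Definition adjmx (x : 'M[K]_n.+1) : 'M[K]_n.+1 := map_mx Num.conj x^T.

Definition mxdouble_star (x : mxdouble) : mxdouble := (adjmx x.2, adjmx x.1).

Lemma adjmxK : involutive adjmx.
Proof. by move=> x; apply/matrixP => i j; rewrite !mxE conjCK. Qed.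

Lemma adjmxD x y : adjmx (x + y) = adjmx x + adjmx y.
Proof. by rewrite /adjmx linearD /= map_mxD. Qed.

Lemma adjmxM x y : adjmx (x * y) = adjmx y * adjmx x.
Proof. by rewrite /adjmx -!mulmxE trmx_mul map_mxM. Qed.

Lemma adjmxZ (k : K) x : adjmx (k *: x) = Num.conj k *: adjmx x.
Proof. by apply/matrixP => i j; rewrite !mxE rmorphM. Qed.

Lemma mxdouble_starK : involutive mxdouble_star.
Proof. by case=> x y; rewrite /mxdouble_star /= !adjmxK. Qed.

Lemma mxdouble_starD x y :
  mxdouble_star (x + y) = mxdouble_star x + mxdouble_star y.
Proof. by rewrite /mxdouble_star /= !adjmxD. Qed.

Lemma mxdouble_starM x y :
  mxdouble_star (x * y) = mxdouble_star y * mxdouble_star x.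
Proof. by rewrite /mxdouble_star /= !adjmxM. Qed.

Lemma mxdouble_starZ (k : K) x :
  mxdouble_star (k *: x) = Num.conj k *: mxdouble_star x.
Proof. by rewrite /mxdouble_star /= !adjmxZ. Qed.

HB.instance Definition _ := isStarAlgebra.Build K mxdouble
  mxdouble_starK mxdouble_starD mxdouble_starM mxdouble_starZ.

End MatrixDouble.

Section FundamentalRep.
Variables (R : realType) (q : R) (q_gt0 : 0 < q).

Definition diag2 (x y : R) : 'M[R[i]]_2 :=
  \matrix_(i, j) (if i == j then (if i == 0 then x%:C else y%:C) else 0).

Lemma adjmx_diag2 x y : adjmx (diag2 x y) = diag2 x y.
Proof.
apply/matrixP => i j; rewrite !mxE eq_sym.
by case: eqP => [->|_]; rewrite ?conjC0 // ; case: ifP; rewrite conjC_real.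
Qed.

(** First component: a, star a, c, star c act by diag(1, 1/q), diag(1, q), the
    matrix unit E_{01} and 0. Its coefficients are the functionals that generate
    a Borel part of the quantised enveloping algebra: the diagonal ones are
    characters, the upper right one is a twisted derivation. *)
Definition dbl_a : mxdouble R[i] 1 := (diag2 1 q^-1, diag2 1 q).
Definition dbl_c : mxdouble R[i] 1 := (delta_mx 0 1, 0).

Lemma star_dbl_a : star dbl_a = (diag2 1 q, diag2 1 q^-1) :> mxdouble R[i] 1.
Proof. by rewrite /star /= /mxdouble_star /= !adjmx_diag2. Qed.

Lemma star_dbl_c : star dbl_c = (0, delta_mx 1 0) :> mxdouble R[i] 1.
Proof.
rewrite /star /= /mxdouble_star /=; congr pair; apply/matrixP => i j;
  by rewrite !mxE ?conjC0 //= andbC; case: (_ && _); rewrite ?conjC1 ?conjC0.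
Qed.

Lemma dbl_relations : SUq2_relations (A := mxdouble R[i] 1) q dbl_a dbl_c.
Proof.
have q0 : q%:C != 0 :> R[i] by rewrite (inj_eq (@complexI _)) gt_eqF.
split; rewrite ?star_dbl_a ?star_dbl_c; congr pair; rewrite -?mulmxE;
  apply/matrixP => i j; rewrite !(mxE, big_ord_recl, big_ord0) /=.
all: case: i => [[|[|i]] ?] //=; case: j => [[|[|j]] ?] //=.
all: rewrite ?(eqE, mulr0, mul0r, addr0, add0r, mulr1, mul1r) //=.
all: by rewrite -rmorphM /= ?mulfV ?mulVf ?gt_eqF.
Qed.

End FundamentalRep.

(** * Slicing the coproduct *)

Section TensorSlices.
Variables (R : realType) (A T : starAlgType R[i]).

Definition lslice (f : {scalar A}) (x y : A) : A := f x *: y.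
Definition rslice (f : {scalar A}) (x y : A) : A := f y *: x.

Lemma lslice_bilinear f : bilinear_for *:%R *:%R (lslice f).
Proof.
split=> u k x y; rewrite /lslice /=.
  by rewrite linearP scalerDl scalerA.
by rewrite scalerDr !scalerA mulrC.
Qed.

Lemma rslice_bilinear f : bilinear_for *:%R *:%R (rslice f).
Proof.
split=> u k x y; rewrite /rslice /=.
  by rewrite scalerDr !scalerA mulrC.
by rewrite linearP scalerDl scalerA.
Qed.

HB.instance Definition _ f :=
  bilinear_isBilinear.Build R[i] A A A *:%R *:%R (lslice f) (lslice_bilinear f).
HB.instance Definition _ f :=
  bilinear_isBilinear.Build R[i] A A A *:%R *:%R (rslice f) (rslice_bilinear f).

Variables (tens : {bilinear A -> A -> T}) (htens : is_tensor_square tens).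

(** Pure tensors span: this is the uniqueness half of the universal property,
    applied to the bilinear map that the two functions share. *)
Lemma tens_ext (V : lmodType R[i]) (g g' : {linear T -> V}) :
  (forall x y, g (tens x y) = g' (tens x y)) -> g =1 g'.
Proof.
move=> gg'; case: htens => _ _ _ univ.
have add1 u : zmod_morphism (fun x => g (tens x u)).
  by move=> x y /=; rewrite linearBl linearB.
have add2 u : zmod_morphism (fun y => g (tens u y)).
  by move=> x y /=; rewrite linearBr linearB.
have sc1 u : scalable (fun x => g (tens x u)).
  by move=> k x /=; rewrite linearZl_LR linearZ.
have sc2 u : scalable (fun y => g (tens u y)).
  by move=> k x /=; rewrite linearZr_LR linearZ.
pose F (x y : A) : V := g (tens x y).
pose FM := isBilinear.Build R[i] A A V *:%R *:%R F add1 add2 sc1 sc2.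
pose FB : {bilinear A -> A -> V} := HB.pack F FM.
have [g0 [_ g0u]] := univ V FB.
by move=> t; rewrite (g0u g) // (g0u g') // => x y; rewrite -gg'.
Qed.

Lemma ex_lslice (f : {scalar A}) :
  exists L : {linear T -> A}, forall x y, L (tens x y) = f x *: y.
Proof.
by case: htens => _ _ _ univ; case: (univ A (lslice f)) => L [hL _]; exists L.
Qed.

Lemma ex_rslice (f : {scalar A}) :
  exists L : {linear T -> A}, forall x y, L (tens x y) = f y *: x.
Proof.
by case: htens => _ _ _ univ; case: (univ A (rslice f)) => L [hL _]; exists L.
Qed.

(** Apply psi to the invariance identity (id (x) phi) Delta x = phi(x) 1 and
    exchange the order of the two slices. *)
Lemma lslice_invariant (Delta : A -> T) (phi psi : {scalar A})
    (L : {linear T -> A}) :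
  (forall x y, L (tens x y) = psi x *: y) -> left_invariant tens Delta phi ->
  forall x, phi (L (Delta x)) = psi 1 * phi x.
Proof.
move=> hL inv x; have [S hS] := ex_rslice phi.
have -> : phi (L (Delta x)) = psi (S (Delta x)).
  pose F : {linear T -> R[i]^o} := phi \o L.
  pose G : {linear T -> R[i]^o} := psi \o S.
  apply: (tens_ext (g := F) (g' := G)) => y z /=.
  by rewrite hL hS !linearZ; exact: mulrC.
by rewrite (inv S hS) linearZ /= mulrC.
Qed.

End TensorSlices.

Section MatrixCoefficients.
Variables (R : realType) (A T : starAlgType R[i]).
Variables (tens : {bilinear A -> A -> T}) (htens : is_tensor_square tens).
Variables (n : nat) (p : {lrmorphism A -> mxdouble R[i] n}).

Definition mxcoef (i j : 'I_n.+1) (x : A) : R[i] := (p x).1 i j.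

Lemma mxcoef_linear i j : linear_for *%R (mxcoef i j).
Proof. by move=> k x y; rewrite /mxcoef linearP !mxE. Qed.

HB.instance Definition _ (r s : 'I_n.+1) :=
  GRing.isLinear.Build R[i] A R[i] *%R (mxcoef r s) (mxcoef_linear r s).

Lemma mxcoefM i j x y : mxcoef i j (x * y) = \sum_k mxcoef i k x * mxcoef k j y.
Proof. by rewrite /mxcoef rmorphM !mxE. Qed.

Lemma mxcoef1 i j : mxcoef i j 1 = (i == j)%:R.
Proof. by rewrite /mxcoef rmorph1 !mxE. Qed.

Variables (L : 'I_n.+1 -> 'I_n.+1 -> {linear T -> A}).
Hypothesis hL : forall i j x y, L i j (tens x y) = mxcoef i j x *: y.

(** The coefficients of a representation p satisfy the comultiplicative rule, so
    slicing the left leg with all of them at once is a homomorphism into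
    matrices over A. It suffices to compare on pure tensors, in each argument
    separately. *)
Lemma mxcoef_lsliceM i j t t' : L i j (t * t') = \sum_k L i k t * L k j t'.
Proof.
have lin1 u : linear (fun t => L i j (t * u)).
  by move=> k x y; rewrite mulrDl -scalerAl linearP.
have lin2 u : linear (fun t => L i j (u * t)).
  by move=> k x y; rewrite mulrDr -scalerAr linearP.
have lin3 (u : T) : linear (fun t => \sum_k L i k t * L k j u).
  move=> k x y; rewrite scaler_sumr -big_split /=; apply: eq_bigr => l _.
  by rewrite linearP mulrDl -scalerAl.
have lin4 (u : T) : linear (fun t => \sum_k L i k u * L k j t).
  move=> k x y; rewrite scaler_sumr -big_split /=; apply: eq_bigr => l _.
  by rewrite linearP mulrDr -scalerAr.
pose pk f (l : linear f) : {linear T -> A} :=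
  HB.pack f (GRing.isLinear.Build _ _ _ _ f l).
apply: (tens_ext htens (g := pk _ (lin1 t')) (g' := pk _ (lin3 t'))).
move=> x y /=.
apply: (tens_ext htens (g := pk _ (lin2 (tens x y)))
  (g' := pk _ (lin4 (tens x y)))) => x' y' /=.
case: htens => tM _ _ _; rewrite tM hL mxcoefM scaler_suml.
by apply: eq_bigr => k _; rewrite !hL -scalerAl -scalerAr scalerA.
Qed.

End MatrixCoefficients.

Section CoefAction.
Variables (R : realType) (q : R) (q_gt0 : 0 < q).
Variables (A : starAlgType R[i]) (a c : A) (hA : is_SUq2 q a c).
Variables (T : starAlgType R[i]) (tens : {bilinear A -> A -> T}).
Variables (htens : is_tensor_square tens).
Variables (Delta : {lrmorphism A -> T}).
Variable (hDelta : is_coproduct q a c tens Delta).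
Variables (phi : {scalar A}) (h_inv : left_invariant tens Delta phi).

(** The matrix of slices of x is upper triangular with diagonal e, k and corner
    d: on words in the generators e is x itself, k a rescaling of x, and d the
    image of x under a derivation twisted by this rescaling. The values are
    given by a predicate because the three maps are computed word by word. *)
Definition upper (th : 'I_2 -> 'I_2 -> A -> A) (x e d k : A) : Prop :=
  [/\ th 0 0 x = e, th 0 1 x = d, th 1 0 x = 0 & th 1 1 x = k].

(** The infinitesimal form of left invariance: phi is invariant under the
    diagonal slices and vanishes on the image of the twisted derivation, which
    sends c to a and star a to - q star c and kills a and star c. *)
Lemma ex_coef_action : exists th : 'I_2 -> 'I_2 -> A -> A,
  [/\ forall x e d k y e' d' k', upper th x e d k -> upper th y e' d' k' ->
        upper th (x * y) (e * e') (e * d' + d * k') (k * k'),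
      upper th 1 1 0 1,
      forall i j x, phi (th i j x) = (i == j)%:R * phi x &
      [/\ upper th a a 0 (q^-1%:C *: a),
          upper th c c a (q%:C *: c),
          upper th (star a) (star a) (- q%:C *: star c) (q%:C *: star a) &
          upper th (star c) (star c) 0 (q^-1%:C *: star c)]].
Proof.
have [rel univ] := hA.
have [p [pstar pa pc _]] := univ _ _ _ (dbl_relations q_gt0).
case: (htens) => tM t1 tstar _; case: (hDelta) => Dstar Da Dc.
have [L hL] : exists L : 'I_2 -> 'I_2 -> {linear T -> A},
    forall i j x y, L i j (tens x y) = mxcoef p i j x *: y.
  have h i j := cid (ex_lslice htens (mxcoef p i j)).
  by exists (fun i j => projT1 (h i j)) => i j; apply: (projT2 (h i j)).
have psa : p (star a) = (diag2 1 q, diag2 1 q^-1).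
  by rewrite pstar pa star_dbl_a.
have psc : p (star c) = (0, delta_mx 1 0) by rewrite pstar pc star_dbl_c.
have sum2 (F : 'I_2 -> A) : \sum_i F i = F 0 + F 1.
  by rewrite !big_ord_recl big_ord0 addr0; congr (_ + F _); apply/val_inj.
exists (fun i j x => L i j (Delta x)); split.
- move=> x e d k y e' d' k'; rewrite /upper /=.
  move=> [x00 x01 x10 x11] [y00 y01 y10 y11].
  split; rewrite rmorphM (mxcoef_lsliceM htens hL) sum2;
    by rewrite ?(x00, x01, x10, x11) ?(y00, y01, y10, y11)
      ?(mul0r, mulr0, addr0, add0r).
- by split; rewrite rmorph1 -t1 hL mxcoef1 ?scale1r ?scale0r.
- by move=> i j x; rewrite (lslice_invariant htens (hL i j) h_inv) /= mxcoef1.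
have Dsa : Delta (star a) = tens (star a) (star a) - q%:C *: tens c (star c).
  by rewrite Dstar Da starD starN starZ conjC_real !tstar starK.
have Dsc : Delta (star c) = tens (star c) (star a) + tens a (star c).
  by rewrite Dstar Dc starD !tstar starK.
do 2!split; rewrite ?(Da, Dc, Dsa, Dsc) ?(linearB, linearD, linearZ) /=.
all: rewrite !hL /mxcoef ?(pa, pc, psa, psc) ?mxE //=.
all: by rewrite ?scale1r ?scale0r ?oppr0 ?scaler0 ?addr0 ?add0r ?scaleNr
  ?scalerN ?scale1r.
Qed.

End CoefAction.

(** * Relations between the generators *)

Section Relations.
Variables (R : realType) (q : R).
Variables (A : starAlgType R[i]) (a c : A) (rel : SUq2_relations q a c).
Local Notation Q := (q%:C : R[i]).
Local Notation B0 := (Bzero c).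
Local Notation Bp := (Bplus a c).
Local Notation Bm := (Bminus a c).

Lemma star_B0 : star B0 = B0.
Proof. by case: rel => _ _ r3 _ _; rewrite /Bzero starM starK. Qed.

Lemma star_Bm : star Bm = Bp.
Proof. by rewrite /Bminus /Bplus starM starK. Qed.

Lemma c_starc : star c * c = B0.
Proof. by case: rel. Qed.

Lemma a_c : a * c = Q *: (c * a). Proof. by case: rel. Qed.

Lemma a_sc : a * star c = Q *: (star c * a). Proof. by case: rel. Qed.

Lemma sa_a : star a * a = 1 - B0.
Proof. by case: rel => _ _ _ <- _; rewrite c_starc addrK. Qed.

Lemma a_sa : a * star a = 1 - Q ^+ 2 *: B0.
Proof. by case: rel => _ _ _ _ <-; rewrite rmorphXn addrK. Qed.

Lemma a_B0 : a * B0 = Q ^+ 2 *: (B0 * a).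
Proof.
by rewrite /Bzero mulrA a_c -scalerAl -(mulrA c a) a_sc -scalerAr scalerA mulrA.
Qed.

Lemma c_B0 : c * B0 = B0 * c.
Proof. by rewrite /Bzero -[RHS]mulrA c_starc. Qed.

Lemma sc_B0 : star c * B0 = B0 * star c.
Proof. by rewrite -[in RHS]c_starc -mulrA. Qed.

Lemma Bm_B0 : Bm * B0 = Q ^+ 2 *: (B0 * Bm).
Proof. by rewrite /Bminus -mulrA sc_B0 mulrA a_B0 -scalerAl mulrA. Qed.

Lemma B0_Bp : B0 * Bp = Q ^+ 2 *: (Bp * B0).
Proof.
by rewrite -[LHS]starK starM star_B0 -star_Bm starK Bm_B0 starZ starM star_B0
  -rmorphXn conjC_real.
Qed.

Lemma Bp_Bm : Bp * Bm = B0 - B0 ^+ 2.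
Proof.
rewrite /Bplus /Bminus mulrA -(mulrA c) sa_a mulrBr mulr1 mulrBl c_B0.
by rewrite -mulrA expr2.
Qed.

Lemma Bm_Bp : Bm * Bp = Q ^+ 2 *: (B0 - Q ^+ 2 *: B0 ^+ 2).
Proof.
rewrite /Bplus /Bminus mulrA -(mulrA a) c_starc a_B0 -scalerAl -mulrA a_sa.
by rewrite mulrBr mulr1 -scalerAr expr2.
Qed.

End Relations.

(** * Moments of the Haar state *)

Section Moments.
Variables (R : realType) (q : R) (q_gt0 : 0 < q) (q_lt1 : q < 1).
Variables (A : starAlgType R[i]) (a c : A) (hA : is_SUq2 q a c).
Variables (T : starAlgType R[i]) (tens : {bilinear A -> A -> T}).
Variables (htens : is_tensor_square tens).
Variables (Delta : {lrmorphism A -> T}).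
Variable (hDelta : is_coproduct q a c tens Delta).
Variables (phi : {scalar A}) (h_inv : left_invariant tens Delta phi).
Local Notation Q := (q%:C : R[i]).
Local Notation B0 := (Bzero c).
Local Notation Bp := (Bplus a c).
Local Notation Bm := (Bminus a c).

(** The q-integer 1 + q^2 + ... + q^(2(k-1)). *)
Definition qnum (k : nat) : R[i] := \sum_(l < k) Q ^+ (2 * l).

Lemma qnumS k : qnum k.+1 = 1 + Q ^+ 2 * qnum k.
Proof.
rewrite /qnum big_ord_recl /= muln0 expr0 mulr_sumr; congr (_ + _).
by apply: eq_bigr => l _; rewrite -exprD -mulnS.
Qed.

Let rel := hA.1.

Let Q0 : Q != 0.
Proof. by rewrite (inj_eq (@complexI _)) gt_eqF. Qed.

Let Qinv : (q^-1)%:C = Q^-1.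
Proof. exact: fmorphV. Qed.

(** The twisted derivation sends B_0^k B_+ to a combination of B_0^k and
    B_0^(k+1), on which phi must vanish. *)
Lemma moment_rec k :
  qnum k.+2 * phi (B0 ^+ k.+1) = qnum k.+1 * phi (B0 ^+ k).
Proof.
have [th [thM th1 thphi [ta tc tsa tsc]]] :=
  ex_coef_action q_gt0 hA htens hDelta h_inv.
have tB0 : upper th B0 B0 (Q^-1 *: Bm) B0.
  have := thM _ _ _ _ _ _ _ _ tc tsc.
  rewrite mulr0 add0r -!scalerAr -scalerAl scalerA Qinv mulVf //.
  by rewrite scale1r.
(* In the slices of B_0^k B_+ the corner d of B_0^k is multiplied by B_+,
   and d B_+ is a polynomial in B_0. *)
have [d td dBp] : exists2 d, upper th (B0 ^+ k) (B0 ^+ k) d (B0 ^+ k) &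
    d * Bp = (Q * qnum k) *: (B0 ^+ k - Q ^+ 2 *: B0 ^+ k.+1).
  elim: k => [|k [d td dBp]].
    by exists 0; rewrite ?expr0 // mul0r /qnum big_ord0 mulr0 scale0r.
  exists (B0 ^+ k * (Q^-1 *: Bm) + d * B0).
    by have := thM _ _ _ _ _ _ _ _ td tB0; rewrite -!exprSr.
  rewrite mulrDl -(mulrA d) (B0_Bp rel) -(scalerAr _ d) (mulrA d) dBp.
  rewrite -scalerAr -scalerAl -mulrA (Bm_Bp rel) qnumS -!scalerAl.
  rewrite -scalerAr mulrBr mulrBl -scalerAr -scalerAl.
  rewrite -!exprSr -exprD addn2 !scalerBr !scalerA addrACA -opprD -!scalerDl.
  by congr (_ *: _ - _ *: _); field; exact: Q0.
have tBp : upper th Bp Bp (Q *: (1 - (1 + Q ^+ 2) *: B0)) (Q ^+ 2 *: Bp).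
  have := thM _ _ _ _ _ _ _ _ tc tsa.
  rewrite -!scalerAr -scalerAl (a_sa rel) scalerA -expr2 scalerDl scale1r opprD.
  by rewrite scaleNr addrC -scalerBr addrA addrAC.
have := thM _ _ _ _ _ _ _ _ td tBp.
case=> _ E _ _; have := thphi 0 1 (B0 ^+ k * Bp).
rewrite E -[d * _]scalerAr dBp /= mul0r.
rewrite -scalerAr mulrBr mulr1 -scalerAr -exprSr.
rewrite !(linearD, linearZ, linearB) /= => E0.
apply/eqP; rewrite -subr_eq0 -(inj_eq (mulfI Q0)) mulr0 -[eqbRHS]oppr0 -E0.
by rewrite !qnumS; apply/eqP; ring.
Qed.

Lemma one_sub_Qexp_neq0 n : 1 - Q ^+ n.+1 != 0.
Proof.
rewrite subr_eq0 eq_sym -rmorphXn -(rmorph1 (real_complex R)).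
by rewrite (inj_eq (@complexI _)) lt_eqF // exprn_ilt1 // ltW.
Qed.

Lemma qnumE k : qnum k = (1 - Q ^+ (2 * k)) / (1 - Q ^+ 2).
Proof.
apply: (canRL (mulfK (one_sub_Qexp_neq0 1))).
elim: k => [|k IH]; first by rewrite /qnum big_ord0 muln0 subrr mul0r.
by rewrite qnumS mulrDl mul1r -mulrA IH mulnS exprD; ring.
Qed.

Hypothesis phi1 : phi 1 = 1.

Lemma momentE k : phi (B0 ^+ k) = (1 - Q ^+ 2) / (1 - Q ^+ (2 * k.+1)).
Proof.
have nz n : qnum n.+1 != 0.
  rewrite qnumE mulf_neq0 ?invr_eq0 ?(one_sub_Qexp_neq0 1) //.
  by rewrite mulnS one_sub_Qexp_neq0.
have -> : phi (B0 ^+ k) = (qnum k.+1)^-1.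
  elim: k => [|k IH].
    by rewrite expr0 phi1 qnumS /qnum big_ord0 mulr0 addr0 invr1.
  by apply: (mulfI (nz k.+1)); rewrite moment_rec IH !mulfV.
by rewrite qnumE invf_div.
Qed.

(** The diagonal slice rescales c and star a by q, a and star c by 1/q, hence
    B_+^j B_0^n B_-^i by q^(2(j-i)), while phi is invariant under it. *)
Lemma moment_weight i j n : i != j -> phi (Bp ^+ j * B0 ^+ n * Bm ^+ i) = 0.
Proof.
move=> ij.
have [th [thM th1 thphi [ta tc tsa tsc]]] :=
  ex_coef_action q_gt0 hA htens hDelta h_inv.
pose wt x u := exists d, upper th x x d (u *: x).
have wtM x y u v : wt x u -> wt y v -> wt (x * y) (u * v).
  move=> [d td] [d' td']; eexists; have := thM _ _ _ _ _ _ _ _ td td'.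
  rewrite -[u *: x * (v *: y)]scalerAl -[x * (v *: y)]scalerAr scalerA.
  exact.
have wtX x u k : wt x u -> wt (x ^+ k) (u ^+ k).
  move=> wx; elim: k => [|k IH]; last by rewrite !exprS; apply: wtM.
  by exists 0; rewrite !expr0 scale1r.
have wc : wt c Q by exists a.
have wa : wt a Q^-1 by exists 0; rewrite -Qinv.
have wsc : wt (star c) Q^-1 by exists 0; rewrite -Qinv.
have wsa : wt (star a) Q by exists (- Q *: star c).
have [d [_ _ _ E]] : wt (Bp ^+ j * B0 ^+ n * Bm ^+ i)
    ((Q * Q) ^+ j * (Q * Q^-1) ^+ n * (Q^-1 * Q^-1) ^+ i).
  exact: (wtM _ _ _ _ (wtM _ _ _ _ (wtX _ _ _ (wtM _ _ _ _ wc wsa))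
    (wtX _ _ _ (wtM _ _ _ _ wc wsc))) (wtX _ _ _ (wtM _ _ _ _ wa wsc))).
have := thphi 1 1 (Bp ^+ j * B0 ^+ n * Bm ^+ i).
rewrite E linearZ /= mul1r mulfV // expr1n mulr1 -invfM exprVn -!expr2 -!exprM.
set x := phi _ => /eqP; rewrite -subr_eq0 -{2}[x]mul1r -mulrBl mulf_eq0.
have /negPf -> : Q ^+ (2 * j) / Q ^+ (2 * i) - 1 != 0.
  rewrite subr_eq0 (can2_eq (divfK _) (mulfK _)) ?expf_neq0 // mul1r.
  rewrite -!rmorphXn (inj_eq (@complexI _)) (inj_eq (ieexprIn q_gt0 _)).
    by rewrite eqn_mul2l /= eq_sym.
  by rewrite (lt_eqF q_lt1).
by move=> /eqP.
Qed.

End Moments.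

(** * A q-beta sequence *)

Section BetaIntegrals.
Variables (R : realType) (q : R) (q_gt0 : 0 < q) (q_lt1 : q < 1).

Fixpoint beta_num (i : nat) : R :=
  if i is i'.+1 then beta_num i' * (q ^+ (2 * i'.+2) * (1 - q ^+ (2 * i'.+1)))
  else 1 - q ^+ 2.

Definition beta_den (k m : nat) : R := \prod_(l < m) (1 - q ^+ (2 * (k + l))).

(** The value of phi on B_+^i B_0^n B_-^i. Under phi, B_0 is distributed on the
    powers of q^2 and B_+^i B_-^i is a polynomial in B_0, so this is a q-beta
    integral; the product formula comes from telescoping in [beta_rec]. As n
    grows it tends to beta_num i, the squared norm of the limit of
    B_0^n B_-^i. *)
Definition beta (i n : nat) : R := beta_num i / beta_den (n + i).+1 i.+1.

Lemma exp_lt1 n : q ^+ n.+1 < 1.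
Proof. by rewrite exprn_ilt1 // ltW. Qed.

Lemma beta_numS i :
  beta_num i.+1 = beta_num i * (q ^+ (2 * i.+2) * (1 - q ^+ (2 * i.+1))).
Proof. by []. Qed.

Lemma beta_num_gt0 i : 0 < beta_num i.
Proof.
elim: i => [|i IH]; first by rewrite subr_gt0 (exp_lt1 1).
by rewrite beta_numS mulr_gt0 // mulr_gt0 ?exprn_gt0 // subr_gt0 mulnS exp_lt1.
Qed.

Lemma beta_denSr k m :
  beta_den k m.+1 = beta_den k m * (1 - q ^+ (2 * (k + m))).
Proof. by rewrite /beta_den big_ord_recr. Qed.

Lemma beta_denSl k m : beta_den k m.+1 = (1 - q ^+ (2 * k)) * beta_den k.+1 m.
Proof.
rewrite /beta_den big_ord_recl addn0; congr (_ * _).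
by apply: eq_bigr => l _; rewrite addnS.
Qed.

Lemma beta_den_gt0 k m : 0 < beta_den k.+1 m.
Proof.
elim: m => [|m IH]; first by rewrite /beta_den big_ord0.
by rewrite beta_denSr mulr_gt0 // subr_gt0 addSn mulnS exp_lt1.
Qed.

Lemma beta_rec i n :
  beta i.+1 n = (q ^+ (2 * n))^-1 * (beta i n.+1 - beta i n.+2).
Proof.
have ne k m : beta_den k.+1 m != 0 by rewrite gt_eqF ?beta_den_gt0.
have fne k : 1 - q ^+ (2 * k.+1) != 0.
  by rewrite subr_eq0 eq_sym lt_eqF // mulnS exp_lt1.
have q0 : q != 0 by rewrite gt_eqF.
rewrite /beta beta_numS [in LHS]beta_denSl [beta_den (n.+1 + i).+1 _]beta_denSl.
rewrite [beta_den _ i.+1 in LHS]beta_denSr [beta_den (n.+2 + i).+1 _]beta_denSr.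
rewrite !addSn !addnS; have := ne (n + i).+2 i.
set D := beta_den _ _ => D0.
have := fne (n + i).+1; have := fne (n + i + i).+2.
rewrite (_ : 2 * (n + i + i).+3 = 2 * n + 2 * (i.+1 + i.+2))%N; last lia.
rewrite (_ : 2 * (n + i).+2 = 2 * n + 2 * i.+2)%N; last lia.
rewrite (_ : 2 * (i.+1 + i.+2) = 2 * i.+1 + 2 * i.+2)%N; last lia.
rewrite !(exprD q (2 * n)) (exprD q (2 * i.+1)).
have := expf_neq0 (2 * n) q0.
set X := q ^+ (2 * n); set Y := q ^+ (2 * i.+2); set Z := q ^+ (2 * i.+1).
by move=> X0 h1 h2; field; rewrite X0 h1 h2 D0.
Qed.

Lemma cvg_exp2 k : (q ^+ (2 * (n + k))) @[n --> \oo] --> (0 : R).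
Proof.
under eq_fun do rewrite mulnDr exprD exprM.
suff : ((q ^+ 2) ^+ n * q ^+ (2 * k)) @[n --> \oo]
    --> (0 * q ^+ (2 * k) : R) by rewrite mul0r.
apply: cvgM; last exact: cvg_cst.
by apply: cvg_expr; rewrite ger0_norm ?exprn_ge0 ?exp_lt1 // ltW.
Qed.

Lemma cvg_beta_den k m : beta_den (n + k) m @[n --> \oo] --> (1 : R).
Proof.
elim: m => [|m IH].
  by under eq_fun do rewrite /beta_den big_ord0; exact: cvg_cst.
under eq_fun do rewrite beta_denSr -addnA.
suff : (beta_den (n + k) m * (1 - q ^+ (2 * (n + (k + m))))) @[n --> \oo]
    --> (1 * (1 - 0) : R) by rewrite subr0 mulr1.
by apply: cvgM => //; apply: cvgB; [exact: cvg_cst|exact: cvg_exp2].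
Qed.

Lemma cvg_beta i : beta i n @[n --> \oo] --> beta_num i.
Proof.
under eq_fun do rewrite /beta -addnS.
suff : (beta_num i / beta_den (n + i.+1) i.+1) @[n --> \oo]
    --> (beta_num i / 1 : R) by rewrite invr1 mulr1.
apply: cvgM; first exact: cvg_cst.
by apply: cvgV; rewrite ?oner_neq0 //; exact: cvg_beta_den.
Qed.

Lemma beta_ge i n : beta_num i <= beta i n.
Proof.
rewrite ler_pdivlMr ?beta_den_gt0 // ler_piMr ?(ltW (beta_num_gt0 _)) //.
elim: i.+1 => [|m IH]; first by rewrite /beta_den big_ord0.
rewrite beta_denSr mulr_ile1 ?(ltW (beta_den_gt0 _ _)) //.
  by rewrite subr_ge0 addSn mulnS ltW ?exp_lt1.
by rewrite lerBlDr lerDl exprn_ge0 // ltW.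
Qed.

End BetaIntegrals.

(** * Pairings of words *)

Section Words.
Variables (R : realType) (q : R) (q_gt0 : 0 < q).
Variables (A : starAlgType R[i]) (a c : A) (rel : SUq2_relations q a c).
Local Notation Q := (q%:C : R[i]).
Local Notation B0 := (Bzero c).
Local Notation Bp := (Bplus a c).
Local Notation Bm := (Bminus a c).

Let Q0 : Q != 0.
Proof. by rewrite (inj_eq (@complexI _)) gt_eqF. Qed.

Lemma B0X_Bp n : B0 ^+ n * Bp = Q ^+ (2 * n) *: (Bp * B0 ^+ n).
Proof.
elim: n => [|n IH]; first by rewrite muln0 !expr0 mul1r mulr1 scale1r.
rewrite exprS -(mulrA B0) IH -scalerAr (mulrA B0) (B0_Bp rel) -scalerAl scalerA.
by rewrite -(mulrA Bp) -exprD addnC -mulnS.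
Qed.

Lemma Bm_B0X n : Bm * B0 ^+ n = Q ^+ (2 * n) *: (B0 ^+ n * Bm).
Proof.
elim: n => [|n IH]; first by rewrite muln0 !expr0 mul1r mulr1 scale1r.
rewrite exprSr (mulrA Bm) IH -scalerAl -(mulrA _ Bm) (Bm_B0 rel) -scalerAr.
by rewrite scalerA (mulrA _ B0) -exprD addnC -mulnS.
Qed.

Lemma BmX_B0X i n :
  Bm ^+ i * B0 ^+ n = (Q ^+ (2 * i)) ^+ n *: (B0 ^+ n * Bm ^+ i).
Proof.
elim: i => [|i IH]; first by rewrite muln0 !expr0 mul1r mulr1 expr1n scale1r.
rewrite exprS -(mulrA Bm) IH -scalerAr (mulrA Bm) Bm_B0X -scalerAl scalerA.
by rewrite -(mulrA _ Bm) -!exprM -exprD -mulnDl mulnS addnC.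
Qed.

Lemma Bm_ca : Bm * (c * a) = Q ^+ 2 *: (B0 * a ^+ 2).
Proof.
rewrite /Bminus -(mulrA a) (mulrA (star c)) (c_starc rel) (mulrA a) (a_B0 rel).
by rewrite -scalerAl -mulrA expr2.
Qed.

Lemma ca_Bm : (c * a) * Bm = Bm * (c * a).
Proof.
rewrite Bm_ca /Bminus mulrA -(mulrA c) -expr2 -(mulrA c) expr2 -(mulrA a).
rewrite (a_sc rel) -scalerAr (mulrA a) (a_sc rel) -scalerAl scalerA -scalerAr.
by rewrite -expr2 -(mulrA _ a) (mulrA c) -expr2.
Qed.

(** Since B_+ B_- = B_0 - B_0^2, sandwiching a power of B_0 between B_+ and B_-
    leaves a polynomial in B_0; this lowers the degree i of a word by one and
    matches the recursion [beta_rec]. *)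
Lemma Bp_B0X_Bm n :
  Bp * B0 ^+ n * Bm = (Q ^+ (2 * n))^-1 *: (B0 ^+ n.+1 - B0 ^+ n.+2).
Proof.
rewrite -[Bp * _](scalerK (expf_neq0 (2 * n) Q0)) -B0X_Bp -scalerAl -mulrA.
by rewrite (Bp_Bm rel) mulrBr -exprSr -exprD addn2.
Qed.

(** The elements c a and B_- differ by exchanging c with star c, which commute
    with B_0 and have the same absolute value, so they have the same effect here
    up to a power of q. *)
Lemma star_ca_B0X_ca n :
  star (c * a) * B0 ^+ n * (c * a) = Q ^- 2 *: (Bp * B0 ^+ n * Bm).
Proof.
have h k : a * B0 ^+ k = Q ^+ (2 * k) *: (B0 ^+ k * a).
  elim: k => [|k IH]; first by rewrite muln0 !expr0 mul1r mulr1 scale1r.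
  rewrite exprSr (mulrA a) IH -scalerAl -(mulrA _ a) (a_B0 rel) -scalerAr.
  by rewrite scalerA (mulrA _ B0) -exprD addnC -mulnS.
have hc : B0 ^+ n * c = c * B0 ^+ n.
  elim: n => [|n IH]; first by rewrite !expr0 mul1r mulr1.
  by rewrite exprS -mulrA IH (mulrA B0) -(c_B0 rel) -mulrA.
have h2 k : star a * B0 ^+ k * a = (Q ^+ (2 * k))^-1 *: (B0 ^+ k - B0 ^+ k.+1).
  have hs : B0 ^+ k * star a = Q ^+ (2 * k) *: (star a * B0 ^+ k).
    have := congr1 star (h k); rewrite starM star_exp (star_B0 rel) starZ starM.
    by rewrite star_exp (star_B0 rel) -rmorphXn conjC_real.
  rewrite -[star a * _](scalerK (expf_neq0 (2 * k) Q0)) -hs -scalerAl -mulrA.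
  by rewrite (sa_a rel) mulrBr mulr1 -exprSr.
rewrite starM mulrA -(mulrA _ _ c) hc -(mulrA (star a)) (mulrA (star c)).
by rewrite (c_starc rel) -exprS h2 Bp_B0X_Bm scalerA -invfM -exprD mulnS.
Qed.

Lemma star_word i m n :
  star (B0 ^+ m * Bm ^+ i) * (B0 ^+ n * Bm ^+ i) =
  Bp ^+ i * B0 ^+ (m + n) * Bm ^+ i.
Proof.
by rewrite starM !star_exp star_Bm (star_B0 rel) -!mulrA exprD -!mulrA.
Qed.

End Words.

Section WordPairings.
Variables (R : realType) (q : R) (q_gt0 : 0 < q) (q_lt1 : q < 1).
Variables (A : starAlgType R[i]) (a c : A) (rel : SUq2_relations q a c).
Local Notation Q := (q%:C : R[i]).
Local Notation B0 := (Bzero c).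
Local Notation Bp := (Bplus a c).
Local Notation Bm := (Bminus a c).
Variable (phi : {scalar A}).
Hypothesis phi_B0 :
  forall k, phi (B0 ^+ k) = (1 - Q ^+ 2) / (1 - Q ^+ (2 * k.+1)).

Lemma phi_word i n : phi (Bp ^+ i * B0 ^+ n * Bm ^+ i) = (beta q i n)%:C.
Proof.
elim: i n => [|i IH] n.
  rewrite !expr0 mul1r mulr1 phi_B0 /beta /beta_den big_ord1 /= !addn0.
  by rewrite !(rmorphM, rmorphB, fmorphV, rmorphXn, rmorph1).
rewrite exprSr [Bm ^+ _]exprS mulrA -(mulrA (Bp ^+ i)) -(mulrA _ _ Bm).
rewrite (Bp_B0X_Bm q_gt0 rel) -scalerAr -scalerAl linearZ /=.
rewrite mulrBr mulrBl linearB /= !IH beta_rec //.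
by rewrite !(rmorphM, rmorphB, fmorphV, rmorphXn).
Qed.

Lemma phi_word_ca i m n :
  phi (star (B0 ^+ m * Bm ^+ i * (c * a)) * (B0 ^+ n * Bm ^+ i * (c * a))) =
  (q ^- 2 * beta q i.+1 (m + n))%:C.
Proof.
have com k : B0 ^+ k * Bm ^+ i * (c * a) = B0 ^+ k * (c * a) * Bm ^+ i.
  rewrite -(mulrA _ _ (c * a)) -(mulrA _ (c * a)); congr (_ * _).
  elim: i => [|i IH].
    by rewrite expr0 mul1r mulr1.
  by rewrite exprS -(mulrA Bm) IH (mulrA Bm) -(ca_Bm rel) -(mulrA _ Bm).
rewrite !com starM starM !star_exp star_Bm (star_B0 rel).
have -> : Bp ^+ i * (star (c * a) * B0 ^+ m) * (B0 ^+ n * (c * a) * Bm ^+ i) =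
    Bp ^+ i * (star (c * a) * B0 ^+ (m + n) * (c * a)) * Bm ^+ i.
  by rewrite exprD !mulrA.
rewrite (star_ca_B0X_ca q_gt0 rel) -scalerAr -scalerAl linearZ /=.
have -> : Bp ^+ i * (Bp * B0 ^+ (m + n) * Bm) * Bm ^+ i =
    Bp ^+ i.+1 * B0 ^+ (m + n) * Bm ^+ i.+1.
  by rewrite exprSr [Bm ^+ i.+1]exprS !mulrA.
by rewrite phi_word [RHS]rmorphM fmorphV; congr (_^-1 * _); rewrite -rmorphXn.
Qed.

End WordPairings.

(** * The functions, the forms and the derivation *)

Section Membership.
Variables (R : realType) (A : starAlgType R[i]) (a c : A).
Local Notation B0 := (Bzero c).
Local Notation Bm := (Bminus a c).
Local Notation CP := (CP1q a c).
Local Notation Om := (Omega01 a c).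

Lemma CP1q_star_subalgebra : star_subalgebra CP.
Proof.
split.
- by move=> S [[]].
- move=> k x y Sx Sy S hS; have [[_ hl _ _] _] := hS.
  by apply: hl; [exact: Sx|exact: Sy].
- move=> x y Sx Sy S hS; have [[_ _ hm _] _] := hS.
  by apply: hm; [exact: Sx|exact: Sy].
- by move=> x Sx S hS; have [[_ _ _ hs] _] := hS; apply: hs; exact: Sx.
Qed.

Lemma Omega01_sub_bimodule : sub_bimodule CP Om.
Proof.
split.
- by move=> S [[]].
- move=> x y Sx Sy S hS; have [[_ hl _ _] _] := hS.
  by apply: hl; [exact: Sx|exact: Sy].
- move=> f x Cf Sx S hS; have [[_ _ hm _] _] := hS.
  by apply: hm => //; exact: Sx.
- move=> f x Cf Sx S hS; have [[_ _ _ hm] _] := hS.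
  by apply: hm => //; exact: Sx.
Qed.

Lemma CP1q1 : CP 1. Proof. by case: CP1q_star_subalgebra. Qed.

Lemma CP1qM x y : CP x -> CP y -> CP (x * y).
Proof. by case: CP1q_star_subalgebra => _ _ + _; apply. Qed.

Lemma CP1qP k x y : CP x -> CP y -> CP (k *: x + y).
Proof. by case: CP1q_star_subalgebra => _ + _ _; apply. Qed.

Lemma CP1q0 : CP 0.
Proof.
by have := CP1qP (-1) CP1q1 CP1q1; rewrite scaleN1r addNr.
Qed.

Lemma CP1qZ k x : CP x -> CP (k *: x).
Proof. by move=> Cx; rewrite -[_ *: _]addr0; apply: CP1qP CP1q0. Qed.

Lemma CP1q_exp x n : CP x -> CP (x ^+ n).
Proof.
move=> Cx; elim: n => [|n IH]; first by rewrite expr0; exact: CP1q1.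
by rewrite exprS; exact: CP1qM.
Qed.

Lemma CP1q_B0 : CP B0. Proof. by move=> S [_]; apply; right. Qed.

Lemma CP1q_Bm : CP Bm. Proof. by move=> S [_]; apply; left; left. Qed.

Lemma Omega01_ca : Om (c * a). Proof. by move=> S [_]; apply; left; right. Qed.

Lemma Omega01_lin (k : R[i]) x y : Om x -> Om y -> Om (k *: x + y).
Proof.
case: Omega01_sub_bimodule => _ hD hM _ Ox Oy; apply: hD => //.
by rewrite -[x]mul1r scalerAl; apply: hM => //; apply: CP1qZ CP1q1.
Qed.

End Membership.

Section Dolbeault.
Variables (R : realType) (q : R) (q_gt0 : 0 < q).
Variables (A : starAlgType R[i]) (a c : A) (rel : SUq2_relations q a c).
Variables (dbar : A -> A) (hdbar : is_dbar q a c dbar).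
Local Notation Q := (q%:C : R[i]).
Local Notation B0 := (Bzero c).
Local Notation Bm := (Bminus a c).
Local Notation CP := (CP1q a c).
Local Notation b := (((Num.sqrt q)^-1)%:C : R[i]).

Let Q0 : Q != 0.
Proof. by rewrite (inj_eq (@complexI _)) gt_eqF. Qed.

Lemma dbar_B0X n :
  dbar (B0 ^+ n.+1) = - (b * qnum q n.+1) *: (B0 ^+ n * (c * a)).
Proof.
case: hdbar => _ dM d0 _ _.
have caB0 k : (c * a) * B0 ^+ k = Q ^+ (2 * k) *: (B0 ^+ k * (c * a)).
  elim: k => [|k IH]; first by rewrite muln0 !expr0 mul1r mulr1 scale1r.
  rewrite exprSr (mulrA (c * a)) IH -scalerAl -(mulrA _ (c * a)) -(mulrA c).
  rewrite (a_B0 rel) -(scalerAr _ c) (mulrA c) (c_B0 rel) -scalerAr scalerA.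
  by rewrite -(mulrA _ c) (mulrA _ B0) -exprD addnC -mulnS.
elim: n => [|n IH].
  by rewrite expr1 d0 expr0 mul1r qnumS /qnum big_ord0 mulr0 addr0 mulr1.
rewrite exprS dM; [|exact: CP1q_B0|apply: CP1q_exp; exact: CP1q_B0].
rewrite d0 IH -scalerAl caB0 -scalerAr (mulrA B0) -exprS scalerA -scalerDl.
congr (_ *: _).
have -> : qnum q n.+2 = qnum q n.+1 + Q ^+ (2 * n.+1).
  by rewrite /qnum big_ord_recr.
by ring.
Qed.

(** Formally dbar f = X f - f X with X proportional to B_0^(-1) c a, and
    B_0^(n+1) B_-^i q-commutes with X; hence the result is a multiple of
    B_0^(n+1) B_-^i X. The induction avoids the inverse of B_0. *)
Lemma dbar_word i n :
  dbar (B0 ^+ n.+1 * Bm ^+ i) =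
  - (b * Q ^- (2 * i) * qnum q (n.+1 + i)) *: (B0 ^+ n * Bm ^+ i * (c * a)).
Proof.
case: (hdbar) => _ dM _ _ dm.
elim: i => [|i IH].
  by rewrite expr0 !mulr1 dbar_B0X muln0 expr0 invr1 mulr1 addn0.
(* Both terms of the Leibniz rule are brought to the word B_-^(i+1) c a. *)
have Ba : B0 * a ^+ 2 = Q ^- 2 *: (Bm * (c * a)).
  by rewrite (Bm_ca rel) scalerK // expf_neq0.
have Cw : CP (B0 ^+ n.+1 * Bm ^+ i).
  by apply: CP1qM; apply: CP1q_exp; [exact: CP1q_B0|exact: CP1q_Bm].
rewrite [in LHS](exprSr Bm) (mulrA _ _ Bm) dM //; last exact: CP1q_Bm.
rewrite IH dm -scalerAl -(mulrA _ (c * a)) (ca_Bm rel) -scalerAr.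
have -> : B0 ^+ n.+1 * Bm ^+ i * a ^+ 2 =
    Q ^- (2 * i.+1) *: (B0 ^+ n * Bm ^+ i * (Bm * (c * a))).
  rewrite exprSr -(mulrA _ B0).
  have -> : B0 * Bm ^+ i = Q ^- (2 * i) *: (Bm ^+ i * B0).
    have := BmX_B0X rel i 1; rewrite !expr1 => ->.
    by rewrite scalerK ?expf_neq0.
  rewrite -(scalerAr _ (B0 ^+ n)) -scalerAl (mulrA _ _ B0) -(mulrA _ B0) Ba.
  by rewrite -scalerAr scalerA -invfM -exprD addnC -mulnS.
rewrite scalerA -scalerDl (mulrA _ Bm) -(mulrA _ _ Bm) -exprSr.
congr (_ *: _); rewrite addnS qnumS mulnS exprD.
move: b => B; field.
by apply/andP; split; [exact: expf_neq0|exact: Q0].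
Qed.

End Dolbeault.

(** * Limits in the GNS space *)

Section ComplexLimits.
Variable R : realType.

Lemma gt0_realC (e : R[i]) : 0 < e -> exists2 r : R, 0 < r & e = r%:C.
Proof.
case: e => x y; rewrite ltcE /= => /andP[/eqP -> x0].
by exists x.
Qed.

Lemma cvg_realC (f : nat -> R) (l : R) :
  f n @[n --> \oo] --> l ->
  ((f n)%:C : R[i]^o) @[n --> \oo] --> (l%:C : R[i]^o).
Proof.
move=> /cvgrPdist_lt fl; apply/cvgrPdist_lt => e /gt0_realC [r r0 ->].
have := fl r r0; apply: filterS => n.
by rewrite -rmorphB normc_def /= expr0n addr0 sqrtr_sqr ltcR.
Qed.

Lemma closure_seq (T : topologicalType) (S : set T) (x : nat -> T) (p : T) :
  (forall n, S (x n)) -> x n @[n --> \oo] --> p -> closure S p.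
Proof.
move=> Sx xp B /xp [n _ /(_ n (leqnn n)) Bn]; by exists (x n).
Qed.

End ComplexLimits.

Lemma cvg_sumv (K : numFieldType) (V : normedModType K) (I : Type) (s : seq I)
    (f : I -> nat -> V) (l : I -> V) :
  (forall k, f k n @[n --> \oo] --> l k) ->
  (\sum_(k <- s) f k n) @[n --> \oo] --> \sum_(k <- s) l k.
Proof.
move=> fl; elim: s => [|k s IH].
  by under eq_fun do rewrite big_nil; rewrite big_nil; exact: cvg_cst.
by under eq_fun do rewrite big_cons; rewrite big_cons; exact: cvgD.
Qed.

Section GNS.
Variables (R : realType) (A : starAlgType R[i]) (phi : {scalar A}).
Variables (H : completeNormedModType R[i]) (j : {linear A -> H}).
Hypothesis j_norm : forall x, `|j x| ^+ 2 = phi (star x * x).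

(** The squared distance of the m-th and n-th terms is
    g(2m) - 2 g(m + n) + g(2n), which is small when g converges. *)
Lemma gram_cvg (x : nat -> A) (g : nat -> R) (l : R) :
  (forall m n, phi (star (x m) * x n) = (g (m + n)%N)%:C) ->
  g n @[n --> \oo] --> l -> cvg (j (x n) @[n --> \oo]).
Proof.
move=> xg /cvgrPdist_lt gl; apply/cauchy_cvgP/cauchy_exP.
move=> e /gt0_realC[r r0 ->].
(* Four terms g k, each within r^2 / 4 of l, enter the squared distance. *)
have r24 : 0 < r ^+ 2 / 4 by rewrite divr_gt0 ?exprn_gt0.
have [N _ hN] := gl _ r24.
exists (j (x N)); exists N => // n /= Nn.
rewrite -ball_normE /= -linearB.
have rC : 0 <= r%:C :> R[i] by rewrite lecR ltW.
rewrite -(ltr_pXn2r (n := 2)) ?nnegrE // j_norm starD starN.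
rewrite mulrDl !mulrDr !mulrN !mulNr !(linearD, linearN) /= !xg.
rewrite -!(rmorphD, rmorphN) -rmorphXn ltcR.
have h k : (N <= k)%N -> l - r ^+ 2 / 4 < g k < l + r ^+ 2 / 4.
  by move=> /hN /=; rewrite distrC ltr_distl.
have /andP[a1 a2] := h (N + N)%N (leq_addr _ _).
have /andP[b1 b2] := h (n + n)%N (leq_trans Nn (leq_addr _ _)).
have /andP[c1 c2] := h (N + n)%N (leq_addr _ _).
rewrite (addnC n N); lra.
Qed.

(** By orthogonality the squared norm of a combination of the n-th terms is a
    sum of nonnegative terms, so each one of them would tend to 0 if the
    combination of the limits vanished. *)
Lemma gram_free (N : nat) (u : 'I_N -> nat -> A) (v : 'I_N -> H)
    (g : 'I_N -> nat -> R) (m : 'I_N -> R) :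
  (forall i k n, phi (star (u i n) * u k n) =
    (if i == k then g i n else 0)%:C) ->
  (forall i, 0 < m i) -> (forall i n, m i <= g i n) ->
  (forall i, j (u i n) @[n --> \oo] --> v i) ->
  forall l : 'I_N -> R[i], \sum_i l i *: v i = 0 -> forall i, l i = 0.
Proof.
move=> ug m0 mg uv l lv0 i; apply/eqP; apply: contraT => li0.
pose w n := \sum_k l k *: u k n.
have w0 : j (w n) @[n --> \oo] --> (0 : H).
  rewrite -lv0; under eq_fun do rewrite linear_sum.
  apply: cvg_sumv => k; under eq_fun do rewrite linearZ.
  exact: cvgZl_tmp.
have wn n : `|l i| ^+ 2 * (m i)%:C <= `|j (w n)| ^+ 2.
  rewrite j_norm star_sum mulr_suml linear_sum /= (bigD1 i) //=.
  have E k : phi (star (l k *: u k n) * w n) = `|l k| ^+ 2 * (g k n)%:C.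
    rewrite starZ -scalerAl linearZ /= mulr_sumr linear_sum (bigD1 k) //=.
    rewrite big1 ?addr0 => [|k' /negPf nk].
      by rewrite -scalerAr linearZ /= ug eqxx normCK mulrA [_ * l k]mulrC.
    by rewrite -scalerAr linearZ /= ug eq_sym nk mulr0.
  rewrite E -[leLHS]addr0 lerD //.
    by rewrite ler_wpM2l ?exprn_ge0 // lecR.
  rewrite sumr_ge0 // => k _; rewrite E mulr_ge0 ?exprn_ge0 // lecR.
  exact: le_trans (ltW (m0 k)) (mg k n).
(* The square of e is the lower bound of [wn]. *)
pose e : R[i] := `|l i| * (Num.sqrt (m i))%:C.
have e0 : 0 < e by rewrite mulr_gt0 ?normr_gt0 // ltcR sqrtr_gt0.
have /cvgr_norm_lt /(_ e) := w0; rewrite normr0 => /(_ e0) [n _ /(_ n)].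
move=> /(_ (leqnn n)) /=; rewrite -(ltr_pXn2r (n := 2)) ?nnegrE ?(ltW e0) //.
rewrite /e exprMn -[X in _ * X](rmorphXn (real_complex R)) sqr_sqrtr;
  last exact: ltW.
move=> lt1.
by have := le_lt_trans (wn n) lt1; rewrite ltxx.
Qed.

End GNS.

(** * Zero modes *)

(** The product of the 1 - X / x_i takes the value 1 at 0, so it equals 1 - X g
    for some polynomial g. *)
Lemma ex_reciprocal_poly (K : fieldType) (x : nat -> K) (N : nat) :
  (forall i, x i != 0) ->
  exists g : {poly K}, forall i, (i < N)%N -> g.[x i] = (x i)^-1.
Proof.
move=> x0; pose P := \prod_(i < N) (1 - (x i)^-1 *: 'X).
have P0 : P.[0] = 1.
  by rewrite horner_prod big1 // => i _; rewrite !hornerE ?mulr0 ?subr0.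
have /factor_theorem[g Eg] : root (1 - P) 0.
  by rewrite rootE !hornerE P0 subrr.
exists g => i iN; apply: (mulIf (x0 i)); rewrite mulVf //.
have Pi : P.[x i] = 0.
  rewrite horner_prod (bigD1 (Ordinal iN)) //= !hornerE mulVf // subrr.
  by rewrite mul0r.
by have := congr1 (horner^~ (x i)) Eg; rewrite !hornerE Pi !subr0 => <-.
Qed.

Section ZeroModes.
Variables (R : realType) (q : R) (q_gt0 : 0 < q) (q_lt1 : q < 1).
Variables (A : starAlgType R[i]) (a c : A) (rel : SUq2_relations q a c).
Variables (dbar : A -> A) (hdbar : is_dbar q a c dbar).
Local Notation Q := (q%:C : R[i]).
Local Notation B0 := (Bzero c).
Local Notation Bm := (Bminus a c).
Local Notation b := (((Num.sqrt q)^-1)%:C : R[i]).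
Variable (phi : {scalar A}).
Hypothesis phi_B0 :
  forall k, phi (B0 ^+ k) = (1 - Q ^+ 2) / (1 - Q ^+ (2 * k.+1)).
Variables (H : completeNormedModType R[i]) (j : {linear A -> H}).
Hypothesis j_norm : forall x, `|j x| ^+ 2 = phi (star x * x).

Lemma word_cvg i : cvg (j (B0 ^+ n * Bm ^+ i) @[n --> \oo]).
Proof.
apply: (gram_cvg j_norm (g := beta q i) (l := beta_num q i));
  last exact: cvg_beta.
by move=> m n; rewrite (star_word rel) (phi_word q_gt0 q_lt1 rel phi_B0).
Qed.

Lemma word_ca_cvg i : cvg (j (B0 ^+ n * Bm ^+ i * (c * a)) @[n --> \oo]).
Proof.
apply: (gram_cvg j_norm (g := fun n => q ^- 2 * beta q i.+1 n)
  (l := q ^- 2 * beta_num q i.+1)).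
  by move=> m n; rewrite (phi_word_ca q_gt0 q_lt1 rel phi_B0).
by apply: cvgM; [exact: cvg_cst|exact: cvg_beta].
Qed.

Lemma CP1q_word n i : CP1q a c (B0 ^+ n * Bm ^+ i).
Proof. by apply: CP1qM; apply: CP1q_exp; [exact: CP1q_B0|exact: CP1q_Bm]. Qed.

(** The limit in n of the coefficients of [dbar_word]. *)
Definition dbar_coef (i : nat) : R[i] := - (b * Q ^- (2 * i) / (1 - Q ^+ 2)).

Variables (i : nat) (v r : H).
Hypothesis v_lim : j (B0 ^+ n * Bm ^+ i) @[n --> \oo] --> v.
Hypothesis r_lim : j (B0 ^+ n * Bm ^+ i * (c * a)) @[n --> \oo] --> r.

Lemma word_shift_cvg k : j (B0 ^+ (n + k) * Bm ^+ i) @[n --> \oo] --> v.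
Proof. by have := v_lim; rewrite -(cvg_shiftn k). Qed.

Lemma word_ca_shift_cvg k :
  j (B0 ^+ (n + k) * Bm ^+ i * (c * a)) @[n --> \oo] --> r.
Proof. by have := r_lim; rewrite -(cvg_shiftn k). Qed.

(** Formally dbar v = X v - v X and X v = 0, since v has its range in the kernel
    of X; the right-hand side is the value of - v X. *)
Lemma dbar_zero_mode : closed_graph a c j dbar (v, dbar_coef i *: r).
Proof.
apply: (@closure_seq _ _
  (fun n => (j (B0 ^+ n.+1 * Bm ^+ i), j (dbar (B0 ^+ n.+1 * Bm ^+ i))))).
  by move=> n; exists (B0 ^+ n.+1 * Bm ^+ i) => //; exact: CP1q_word.
apply: cvg_pair => /=.
  by have := word_shift_cvg 1; under eq_fun do rewrite addn1.
under eq_fun do rewrite (dbar_word q_gt0 rel hdbar) linearZ /=.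
have coefE n : - (b * Q ^- (2 * i) * qnum q (n.+1 + i)) = dbar_coef i *
    (1 - q ^+ (2 * (n + i.+1)))%:C.
  rewrite (qnumE q_gt0 q_lt1) addSnnS /dbar_coef rmorphB rmorph1 rmorphXn.
  by rewrite mulNr mulrA mulrAC.
under eq_fun do rewrite coefE -scalerA.
apply: cvgZl_tmp; rewrite -[r]scale1r.
have lim1 : (1 - q ^+ (2 * (n + i.+1))) @[n --> \oo] --> (1 - 0 : R).
  by apply: cvgB; [exact: cvg_cst|exact: cvg_exp2].
by have := cvgZ (cvg_realC lim1) r_lim; rewrite subr0; apply.
Qed.

(** With g interpolating 1 / t at t = 1, q^2, ..., q^(2(N-1)), adding this form
    to the element X with dbar f = X f - f X kills its first N weights. *)
Definition cutoff_form (g : {poly R[i]}) : A :=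
  - (b / (1 - Q ^+ 2)) *: \sum_(l < size g) g`_l *: (B0 ^+ l * (c * a)).

(** Moving the powers of B_0 in the form to the left of B_-^i rescales
    B_0 by q^(2i), and further powers of B_0 do not change the limit: all that
    remains of g is its value at q^(2i). *)
Lemma cutoff_zero_mode (g : {poly R[i]}) : g.[Q ^+ (2 * i)] = Q ^- (2 * i) ->
  closed_graph a c j (fun s => s * cutoff_form g) (v, dbar_coef i *: r).
Proof.
move=> gi.
apply: (@closure_seq _ _
  (fun n => (j (B0 ^+ n * Bm ^+ i), j (B0 ^+ n * Bm ^+ i * cutoff_form g)))).
  by move=> n; exists (B0 ^+ n * Bm ^+ i) => //; exact: CP1q_word.
apply: cvg_pair => //=.
have -> : dbar_coef i *: r = - (b / (1 - Q ^+ 2)) *: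
    \sum_(l < size g) (g`_l * Q ^+ (2 * i) ^+ l) *: r.
  rewrite -scaler_suml -horner_coef gi scalerA; congr (_ *: _).
  by rewrite /dbar_coef mulrAC mulNr.
rewrite /cutoff_form; under eq_fun do
  rewrite -scalerAr linearZ mulr_sumr linear_sum.
apply: cvgZl_tmp; apply: cvg_sumv => l.
have E n : j (B0 ^+ n * Bm ^+ i * (g`_l *: (B0 ^+ l * (c * a)))) =
    (g`_l * Q ^+ (2 * i) ^+ l) *: j (B0 ^+ (n + l) * Bm ^+ i * (c * a)).
  rewrite -scalerAr (mulrA _ _ (c * a)) -(mulrA (B0 ^+ n)) (BmX_B0X rel).
  by rewrite -scalerAr (mulrA (B0 ^+ n)) -exprD -scalerAl scalerA linearZ.
under eq_fun do rewrite E.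
by apply: cvgZl_tmp; exact: word_ca_shift_cvg.
Qed.

End ZeroModes.

Theorem proposition1p2 (R : realType) (q : R) (q_gt0 : 0 < q) (q_lt1 : q < 1)
    (A : starAlgType R[i]) (a c : A) (hA : is_SUq2 q a c)
    (T : starAlgType R[i]) (tens : {bilinear A -> A -> T})
    (htens : is_tensor_square tens)
    (Delta : {lrmorphism A -> T}) (hDelta : is_coproduct q a c tens Delta)
    (C : cstarAlgType R[i]) (aC cC : C) (hC : is_cstar_SUq2 q aC cC)
    (iota : {lrmorphism A -> C}) (iota_star : star_preserving iota)
    (iota_a : iota a = aC) (iota_c : iota c = cC)
    (h : {scalar C}) (h_state : is_state h)
    (h_inv : left_invariant tens Delta (h \o iota))
    (H : completeNormedModType R[i]) (dot : {dot H for Num.conj})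
    (Lambda : {linear C -> H}) (hGNS : is_GNS_space h dot Lambda)
    (dbar : A -> A) (hdbar : is_dbar q a c dbar)
    (N : nat) :
  exists (nabla : A -> A) (theta : A),
    [/\ is_dbar_connection a c dbar nabla,
        Omega01 a c theta,
        forall s, CP1q a c s -> nabla s = dbar s - s * theta &
        dim_ge (ker_nabla a c (Lambda \o iota) dbar theta) N].
Proof.
have [rel _] := hA.
pose phi : {scalar A} := h \o iota.
pose j : {linear A -> H} := Lambda \o iota.
have phi1 : phi 1 = 1 by case: h_state => _ h1; rewrite /phi /= rmorph1.
have phi_B0 := momentE q_gt0 q_lt1 hA htens hDelta h_inv phi1.
have j_norm x : `|j x| ^+ 2 = phi (star x * x).
  case: hGNS => normE dotE _.
  rewrite normE; apply: etrans (dotE _ _) _.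
  by rewrite -iota_star -rmorphM.
have Qi0 i : (q%:C : R[i]) ^+ (2 * i) != 0.
  by rewrite expf_neq0 // (inj_eq (@complexI _)) gt_eqF.
have [g gE] := ex_reciprocal_poly N Qi0.
pose th := cutoff_form q a c g.
have Oth : Omega01 a c th.
  rewrite /th /cutoff_form -[_ *: _]addr0.
  have [z0 _ OM _] := Omega01_sub_bimodule a c.
  apply: Omega01_lin => //; elim/big_ind: _ => // [x y Ox Oy|l _].
    by rewrite -[x]scale1r; exact: Omega01_lin.
  rewrite -[_ *: _]addr0; apply: Omega01_lin => //.
  by apply: OM; [apply: CP1q_exp; exact: CP1q_B0|exact: Omega01_ca].
exists (fun s => dbar s - s * th), th; split => //.
- have [[dO dlin] dM _ _ _] := hdbar.
  have [z0 hD OM _] := Omega01_sub_bimodule a c.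
  split; [split|].
  + move=> x Cx; rewrite addrC -scaleN1r; apply: Omega01_lin; last exact: dO.
    exact: OM.
  + move=> k x y Cx Cy; rewrite dlin // mulrDl opprD -scalerAl scalerBr.
    by rewrite addrACA.
  + by move=> f s Cf Cs; rewrite dM // mulrBr -addrA -mulrA.
- pose v (i : 'I_N) := lim (j (Bzero c ^+ n * Bminus a c ^+ i) @[n --> \oo]).
  have v_lim (i : 'I_N) :
      j (Bzero c ^+ n * Bminus a c ^+ i) @[n --> \oo] --> v i.
    exact: (word_cvg q_gt0 q_lt1 rel phi_B0 j_norm).
  exists v; split=> [i|].
    have /cvg_ex[r r_lim] := word_ca_cvg q_gt0 q_lt1 rel phi_B0 j_norm (i := i).
    exists (dbar_coef q i *: r), (dbar_coef q i *: r); split.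
    + exact: (dbar_zero_mode q_gt0 q_lt1 rel hdbar (v_lim i) r_lim).
    + exact: (cutoff_zero_mode rel (v_lim i) r_lim (gE i (ltn_ord i))).
    + by rewrite subrr.
  apply: (gram_free (u := fun i n => Bzero c ^+ n * Bminus a c ^+ i)
    (g := fun i n => beta q i (n + n)) (m := fun i => beta_num q i)
    j_norm) => //.
  + move=> i k n; case: eqP => [->|/eqP ik].
      by rewrite (star_word rel) (phi_word q_gt0 q_lt1 rel phi_B0).
    rewrite starM !star_exp star_Bm (star_B0 rel) -!mulrA (mulrA (_ ^+ n)).
    rewrite -exprD mulrA.
    rewrite (moment_weight q_gt0 q_lt1 hA htens hDelta h_inv) //.
    by rewrite eq_sym.
  + by move=> i; exact: beta_num_gt0.
  + by move=> i n; exact: beta_ge.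
Qed.
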